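(* Let $M$ be a $C$-algebra with $T,F,U$. If $M_{\#}$ is non-atomic, then $M$ is non-atomic.
   Context: A $C$-algebra is an algebra $\langle M,\vee,\wedge,\neg\rangle$ of type $(2,2,1)$ satisfying, for all $\alpha,\beta,\gamma$: $\neg\neg\alpha=\alpha$; $\neg(\alpha\wedge\beta)=\neg\alpha\vee\neg\beta$; $(\alpha\wedge\beta)\wedge\gamma=\alpha\wedge(\beta\wedge\gamma)$; $\alpha\wedge(\beta\vee\gamma)=(\alpha\wedge\beta)\vee(\alpha\wedge\gamma)$; $(\alpha\vee\beta)\wedge\gamma=(\alpha\wedge\gamma)\vee(\neg\alpha\wedge\beta\wedge\gamma)$; $\alpha\vee(\alpha\wedge\beta)=\alpha$; $(\alpha\wedge\beta)\vee(\beta\wedge\alpha)=(\beta\wedge\alpha)\vee(\alpha\wedge\beta)$. A $C$-algebra with $T,F,U$ has nullary operations $T,F,U$ where $T$ is the two-sided identity for $\wedge$, $F$ the two-sided identity for $\vee$, and $U$ the fixed point of $\neg$. $M_{\#} = \{\alpha \in M : \alpha\vee\neg\alpha = T\}$ (a Boolean algebra under the induced operations, containing $T,F$). Order: $a\leq b$ iff $a\vee b=b$. For a subset $A\subseteq M$ containing $F$, the atoms relative to $A$ are the $a \in A$, $a\neq F$, such that every $b\in A$ with $F\leq b\leq a$, $b\neq a$ equals $F$ (for $A=M$ these are the atoms of $M$). For finitely many elements $a_1,\dots,a_N$: if $a_{\sigma(1)}\vee\cdots\vee a_{\sigma(N)} = a_1\vee\cdots\vee a_N$ for every bijection $\sigma$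 of $\{1,\dots,N\}$, then $\bigoplus_{i=1}^N a_i$ exists and equals this value. $A$ (either $M$ or $M_\#$) is atomic if every $a\in A$, $a\neq F$, equals $\bigoplus_{i=1}^N a_i$ for some finite set of atoms relative to $A$; non-atomic means not atomic. *)

(* Defs.v *)
From HB Require Import structures.
From mathcomp Require Import all_boot all_fingroup.
From mathcomp Require Import classical_sets.

Set Implicit Arguments.
Unset Strict Implicit.
Unset Printing Implicit Defensive.

Declare Scope calg_scope.
Delimit Scope calg_scope with calg.
Local Open Scope classical_set_scope.
Local Open Scope calg_scope.

HB.mixin Record isCAlgebra M := {
  cor : M -> M -> M;
  cand : M -> M -> M;
  cneg : M -> M;
  cnegK : forall a, cneg (cneg a) = a;
  cneg_and : forall a b, cneg (cand a b) = cor (cneg a) (cneg b);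
  candA : forall a b c, cand (cand a b) c = cand a (cand b c);
  cand_orr : forall a b c, cand a (cor b c) = cor (cand a b) (cand a c);
  cand_orl : forall a b c,
    cand (cor a b) c = cor (cand a c) (cand (cand (cneg a) b) c);
  cor_andK : forall a b, cor a (cand a b) = a;
  cor_andC : forall a b,
    cor (cand a b) (cand b a) = cor (cand b a) (cand a b)
}.

#[short(type="cAlgebraType")]
HB.structure Definition CAlgebra := {M of isCAlgebra M}.

Notation "a \v b" := (cor a b) (at level 50, left associativity) : calg_scope.
Notation "a \^ b" := (cand a b) (at level 40, left associativity) : calg_scope.
Notation "\~ a" := (cneg a) (at level 35, right associativity) : calg_scope.

HB.mixin Record CAlgebra_hasTFU M of CAlgebra M := {
  cT : M;
  cF : M;
  cU : M;
  candTl : forall a : M, cand cT a = a;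
  candTr : forall a : M, cand a cT = a;
  corFl : forall a : M, cor cF a = a;
  corFr : forall a : M, cor a cF = a;
  cnegU : cneg cU = cU
}.

#[short(type="cAlgebraTFUType")]
HB.structure Definition CAlgebraTFU := {M of isCAlgebra M & CAlgebra_hasTFU M}.

Definition cle (M : cAlgebraType) (a b : M) : Prop := a \v b = b.
Notation "a <=c b" := (cle a b) (at level 70, no associativity) : calg_scope.

Definition chash (M : cAlgebraTFUType) : set M := [set a | a \v \~ a = cT].

Definition relative_atom (M : cAlgebraTFUType) (A : set M) (a : M) : Prop :=
  [/\ A a, a <> cF &
      forall b, A b -> cF <=c b -> b <=c a -> b <> a -> b = cF].

(* The join is not commutative: the bigop is the join in increasing order of
   the index (the unit cF makes it the plain iterated join for N > 0). *)
Definition bigcor (M : cAlgebraTFUType) (N : nat) (a : 'I_N -> M) : M :=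
  \big[@cor M/cF]_(i < N) a i.

Definition is_oplus (M : cAlgebraTFUType) (N : nat) (a : 'I_N -> M) (s : M)
    : Prop :=
  (forall sigma : {perm 'I_N}, bigcor (fun i => a (sigma i)) = bigcor a) /\
  s = bigcor a.

(* A finite set of atoms is an injective family; N = 0 contributes nothing,
   as its sum would be cF. *)
Definition atomic (M : cAlgebraTFUType) (A : set M) : Prop :=
  forall a : M, A a -> a <> cF ->
    exists (N : nat) (s : 'I_N -> M),
      [/\ injective s, (forall i, relative_atom A (s i)) & is_oplus s a].

(* Main.v *)
(** If [a] lies in [M_#] and [a] is the sum of atoms [s i] of [M], reorder the
    sum so that a given [s i] comes first: then [a = s i \v r], which forces
    [s i] into [M_#] (pointwise in the three-element algebra, a value [U] of
    the first summand would survive in [a]).  So the same family of atoms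
    witnesses atomicity of [a] relative to [M_#]. *)
Require Import Defs.
From HB Require Import structures.
From mathcomp Require Import all_boot all_fingroup.
From mathcomp Require Import classical_sets.

Set Implicit Arguments.
Unset Strict Implicit.
Unset Printing Implicit Defensive.

Local Open Scope classical_set_scope.
Local Open Scope calg_scope.

Lemma corA (M : cAlgebraType) (a b c : M) : (a \v b) \v c = a \v (b \v c).
Proof.
rewrite -[a]cnegK -[b]cnegK -[c]cnegK -!cneg_and.
by rewrite candA.
Qed.

Lemma corxx (M : cAlgebraTFUType) (a : M) : a \v a = a.
Proof. by rewrite -{2}[a]candTr cor_andK. Qed.

(** Right distributivity at [b = c = cT]. It turns membership in [chash M] into the negation-free
    equation [a \v cT = cT]. *)
Lemma corT (M : cAlgebraTFUType) (a : M) : a \v cT = a \v \~ a.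
Proof. by have := cand_orl a cT cT; rewrite !candTr. Qed.

Lemma chash_corl (M : cAlgebraTFUType) (p r : M) :
  chash (p \v r) -> chash p.
Proof.
rewrite /chash /= => pr_hash.
(* The goal becomes [p \v cT = cT]. The hypothesis writes [cT] as a join beginning with [p], so
   idempotence absorbs the extra [p]. *)
by rewrite -corT -pr_hash -!corA corxx.
Qed.

Lemma bigcor_first (M : cAlgebraTFUType) (N : nat) (s : 'I_N -> M) (i : 'I_N) :
  exists (sigma : {perm 'I_N}) (r : M),
    bigcor (fun j => s (sigma j)) = s i \v r.
Proof.
case: N s i => [|n] s i; first by case: i.
exists (tperm ord0 i); rewrite /bigcor big_ord_recl tpermL.
by eexists.
Qed.

Theorem theorem2p45 (M : cAlgebraTFUType) :
  ~ atomic (@chash M) -> ~ atomic (@setT M).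
Proof.
move=> nonatomic atomicM; apply: nonatomic => a a_hash aN0.
have [N [s [s_inj s_atom a_sum]]] := atomicM a I aN0.
exists N, s; split=> // i.
have [_ siN0 si_min] := s_atom i; split=> //; last first.
  by move=> b _; apply: si_min.
have [sum_perm aE] := a_sum.
have [sigma [r sigmaE]] := bigcor_first s i.
by apply: (@chash_corl _ _ r); rewrite -sigmaE sum_perm -aE.
Qed.
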